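(* Let $d\ge 3$ and $m\ge 1$ be integers, let $\beta>2$ be real, and let $n\ge m+1$ be an integer. There is $p>0$ (depending only on $d,m,\beta,n$) such that, for the CAT Markov chain $(\mathcal C_t)_{t\ge0}$ with parameters $(d,m,\beta)$, $$\mathbf P_C\big(\mathcal C_{2n^2r}\in\mathsf{CanPersist}_r\big)\ge p^r$$ for every $n$-element subset $C$ of $\mathbb Z^d$ and every integer $r\ge 2n$.
   Context: $\|\cdot\|$ is the Euclidean norm; $\mathrm{dist}(A,B)=\inf_{x\in A,y\in B}\|x-y\|$ (with $\inf\emptyset=\infty$). For $A\subset\mathbb Z^d$, $\partial A=\{x\in\mathbb Z^d\setminus A:\ \|x-y\|=1\text{ for some }y\in A\}$. Let $\phi(u,v)=\max\{\|u-v\|,1\}^{-\beta}$ for $u,v\in\mathbb Z^d$. CAT (chain activation and transport) is the Markov chain $(\mathcal C_t)_{t\ge0}$ on $\mathcal S=\{S\subset\mathbb Z^d: m+1\le|S|<\infty\}$ with the following step. Given $\mathcal C_t$, choose $x_1$ uniformly at random in $\mathcal C_t$; for $l=1,\dots,m-1$, given $x_1,\dots,x_l$, choose $x_{l+1}\in\mathcal C_t\setminus\{x_1,\dots,x_l\}$ with probability proportional to $\phi(x_l,x_{l+1})$; then for $l=m,\dots,2m-1$, given $x_1,\dots,x_l$, choose $x_{l+1}\in\partial\big((\mathcal C_t\setminus\{x_1,\dots,x_m\})\cup\{x_{m+1},\dots,x_l\}\big)$ with probability proportional to $\phi(x_l,x_{l+1})$. Set $\mathcal C_{t+1}=(\mathcal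 C_t\setminus\{x_1,\dots,x_m\})\cup\{x_{m+1},\dots,x_{2m}\}$. $\mathbf P_C$ is the law of the chain started from $\mathcal C_0=C$. Let $e_1$ be the first standard unit vector and $\mathcal L=\big\{\{x+e_1,x+2e_1,\dots,x+ke_1\}: k\in\mathbb Z_{\ge1},\ x\in\mathbb Z^d\big\}$ the collection of line segments parallel to $e_1$. For $r\ge0$, $\mathsf{CanPersist}_r$ is the set of $S\in\mathcal S$ that have a partition $(V^j)_{j=1}^J$ such that, for every $j\in\{1,\dots,J\}$: $V^j\in\mathcal L$, $m+1\le|V^j|\le 2m+1$, and $\mathrm{dist}\big(V^j,\bigcup_{i\ne j}V^i\big)\ge r$. *)

(* Defs.v *)
From HB Require Import structures.
From mathcomp Require Import all_boot all_order all_algebra finmap.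
From mathcomp Require Import all_classical all_reals all_analysis.
Set Implicit Arguments.
Unset Strict Implicit.
Unset Printing Implicit Defensive.
Import Order.TTheory GRing.Theory Num.Theory.
Local Open Scope classical_set_scope.
Local Open Scope ring_scope.

(* The norm that MathComp-Analysis puts on row vectors is the sup norm. *)
Definition enorm (R : realType) (d : nat) (x : 'rV[int]_d) : R :=
  Num.sqrt (\sum_(i < d) ((x 0 i)%:~R : R) ^+ 2).

Definition dist (R : realType) (d : nat) (A B : set 'rV[int]_d) : \bar R :=
  ereal_inf [set (enorm R (x - y))%:E | x in A & y in B].

Definition boundary (R : realType) (d : nat) (A : set 'rV[int]_d) :
    set 'rV[int]_d :=
  [set x | ~ A x /\ exists y, A y /\ enorm R (x - y) = 1].

Definition phi (R : realType) (d : nat) (beta : R) (u v : 'rV[int]_d) : R :=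
  Num.max (enorm R (u - v)) 1 `^ (- beta).

(* A step of CAT is encoded by the sequence x of its 2m choices, indexed from
   0: x_{l+1} is x`_l and {x_1, ..., x_l} is take l x. *)

(* The configuration when x_1, ..., x_l have been chosen, for m <= l. *)
Definition partial_update (d m : nat) (C : {fset 'rV[int]_d})
    (x : seq 'rV[int]_d) (l : nat) : {fset 'rV[int]_d} :=
  ((C `\` [fset y in take m x]) `|` [fset y in drop m (take l x)])%fset.

(* The set in which x_{l+1} is chosen, given x_1, ..., x_l. *)
Definition choice_set (R : realType) (d m : nat) (C : {fset 'rV[int]_d})
    (x : seq 'rV[int]_d) (l : nat) : set 'rV[int]_d :=
  if (l < m)%N then [set` (C `\` [fset y in take l x])%fset]
  else boundary R [set` partial_update m C x l].

Definition choice_weight (R : realType) (d : nat) (beta : R)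
    (x : seq 'rV[int]_d) (l : nat) (y : 'rV[int]_d) : R :=
  if l is k.+1 then phi beta (nth 0 x k) y else 1.

(* The conditional probability of choosing x_{l+1} given x_1, ..., x_l; every
   choice_set is finite, so the denominator is a genuine sum. *)
Definition choice_prob (R : realType) (d m : nat) (beta : R)
    (C : {fset 'rV[int]_d}) (x : seq 'rV[int]_d) (l : nat) : R :=
  if nth 0 x l \in choice_set R m C x l then
    choice_weight beta x l (nth 0 x l) /
    \sum_(y \in choice_set R m C x l) choice_weight beta x l y
  else 0.

Definition cat_transition (R : realType) (d m : nat) (beta : R)
    (C D : {fset 'rV[int]_d}) : \bar R :=
  \esum_(x in [set x : (2 * m)%N.-tuple 'rV[int]_d |
               partial_update m C x (2 * m)%N = D])
    (\prod_(l < (2 * m)%N) choice_prob m beta C x l)%:E.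

(* X is a Markov chain started from c with transition probabilities K, the
   state space T being discrete; the conditional probabilities given the past
   are written in product form. *)
Definition markov_chain (R : realType) (dO : measure_display)
    (Omega : measurableType dO) (P : probability Omega R) (T : Type)
    (K : T -> T -> \bar R) (c : T) (X : nat -> Omega -> T) : Prop :=
  [/\ forall (t : nat) (A : set T), measurable (X t @^-1` A),
      P [set w | X 0%N w = c] = 1%E
    & forall (t : nat) (s : nat -> T),
        P [set w | forall i, (i <= t.+1)%N -> X i w = s i] =
        (P [set w | forall i, (i <= t)%N -> X i w = s i] *
         K (s t) (s t.+1))%E].

Definition cat_states (d m : nat) : set {fset 'rV[int]_d} :=
  [set S | (m + 1 <= #|` S|%fset)%N].

Definition cat_chain (R : realType) (d m : nat) (beta : R)
    (dO : measure_display) (Omega : measurableType dO)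
    (P : probability Omega R) (C : {fset 'rV[int]_d})
    (X : nat -> Omega -> {fset 'rV[int]_d}) : Prop :=
  (forall t w, cat_states m (X t w)) /\
  markov_chain P (cat_transition m beta) C X.

Definition e1 (d : nat) : 'rV[int]_d := \row_(j < d) (j == 0%N :> nat)%:R.

Definition segments (d : nat) : set (set 'rV[int]_d) :=
  [set L | exists (k : nat) (x : 'rV[int]_d), (1 <= k)%N /\
     L = [set x + e1 d *+ i | i in [set i : nat | (1 <= i <= k)%N]]].

Definition CanPersist (R : realType) (d m : nat) (r : R) :
    set {fset 'rV[int]_d} :=
  [set S | cat_states m S /\
     exists (J : nat) (V : 'I_J -> {fset 'rV[int]_d}),
       [/\ forall j, (V j != fset0)%fset,
           forall i j, i != j -> [disjoint V i & V j]%fset,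
           [set` S] = \bigcup_(j in [set: 'I_J]) [set` V j]
         & forall j : 'I_J,
             [/\ segments [set` V j],
                 (m + 1 <= #|` V j|%fset <= 2 * m + 1)%N
               & (r%:E <= dist R [set` V j]
                           (\bigcup_(i in [set i | i != j]) [set` V i]))%E]]].

(* Main.v *)
(* Every step of the strategy below has probability bounded below by a constant
   depending on d, m, beta, n only, because each choice is either within a
   bounded distance of the previous one or maximizes phi over the choice set.

   Gathering: start from the partition of C into singletons.  While some part
   has at most m elements, activate all of it first, complete the activation
   greedily and send the first particle greedily to some site next to a
   remaining z; the other particles stay close to it and all of them join the
   part of z.  This removes a part and increases the diameters by a constant, so
   after at most n steps all parts have bounded diameter and more than m
   elements, whatever the mutual distances of the points of C.

   Spreading: take a rightmost point y (in direction e_1) not yet treated and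
   m + 1 to 2m + 1 points of its part, line them up to the right of y in two
   steps, and slide the segment to the right, past all sites occupied by the
   untreated points, over a distance proportional to r and to the number of
   untreated points.  The segments treated earlier have been sent further away,
   so nothing is ever in the way.

   Idling: a segment with more than m elements can lose its m leftmost elements
   and get them back in the same step, which fills up the remaining time. *)
Require Import Defs.
From HB Require Import structures.
From mathcomp Require Import all_boot all_order all_algebra finmap.
From mathcomp Require Import all_classical all_reals all_analysis.
From mathcomp Require Import zify.
Import Order.TTheory GRing.Theory Num.Theory.
Local Open Scope classical_set_scope.
Local Open Scope ring_scope.
Set Implicit Arguments.
Unset Strict Implicit.
Unset Printing Implicit Defensive.

(* Closeness is measured in the sup norm, where the triangle inequality is
   immediate; it bounds enorm up to a factor d. *)
Definition near_by (d K : nat) (u v : 'rV[int]_d) : Prop :=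
  forall i, `|u 0 i - v 0 i| <= K%:Z.

Lemma near_by_sym (d K : nat) (u v : 'rV[int]_d) :
  near_by K u v -> near_by K v u.
Proof. by move=> h i; rewrite distrC. Qed.

Lemma near_by_refl (d K : nat) (u : 'rV[int]_d) : near_by K u u.
Proof. by move=> i; rewrite subrr normr0. Qed.

Lemma near_by_trans (d K1 K2 K : nat) (u v w : 'rV[int]_d) :
  (K1 + K2 <= K)%N -> near_by K1 u v -> near_by K2 v w -> near_by K u w.
Proof.
move=> le h1 h2 i; apply: (le_trans (ler_distD (v 0 i) _ _)).
have := h1 i; have := h2 i; lia.
Qed.

Lemma near_by_le (d K1 K : nat) (u v : 'rV[int]_d) :
  (K1 <= K)%N -> near_by K1 u v -> near_by K u v.
Proof. by move=> le h i; have := h i; lia. Qed.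

(** * Euclidean norm and the kernel [phi] against the sup norm *)

Section Norm.
Variables (R : realType) (d : nat).
Implicit Types x u v : 'rV[int]_d.

Lemma enorm_ge0 x : 0 <= enorm R x. Proof. exact: sqrtr_ge0. Qed.

Lemma enormN x : enorm R (- x) = enorm R x.
Proof. by congr Num.sqrt; apply: eq_bigr => i _; rewrite mxE rmorphN sqrrN. Qed.

Lemma coord_le_enorm x i : `|(x 0 i)%:~R : R| <= enorm R x.
Proof.
rewrite -sqrtr_sqr ler_sqrt; last by apply: sumr_ge0 => j _; exact: sqr_ge0.
by rewrite (bigD1 i) //= lerDl sumr_ge0 // => j _; exact: sqr_ge0.
Qed.

Lemma enorm_le_near K u v : near_by K u v -> enorm R (u - v) <= (d * K)%:R.
Proof.
move=> h; rewrite -(@ler_pXn2r _ 2) ?nnegrE ?enorm_ge0 //.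
rewrite sqr_sqrtr ?sumr_ge0 // => [|i _]; last exact: sqr_ge0.
apply: (@le_trans _ _ (\sum_(i < d) (K%:R : R) ^+ 2)).
  apply: ler_sum => i _; rewrite -real_normK ?num_real // ler_pXn2r ?nnegrE //.
  have := h i; rewrite -(ler_int R) intr_norm !mxE; exact.
rewrite sumr_const card_ord -!natrX -mulrnA ler_nat expnMn mulnC leq_mul2r.
by apply/orP; right; rewrite -mulnn; case: (d) => // k; rewrite leq_pmulr.
Qed.

Lemma enorm_eq1_coord x i : enorm R x = 1 -> `|x 0 i| <= 1.
Proof. by move=> h; rewrite -(ler_int R) intr_norm (le_trans (coord_le_enorm _ _)) // h. Qed.

Lemma phi_ge0 (beta : R) u v : 0 <= phi beta u v.
Proof. exact: powR_ge0. Qed.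

Lemma phi_le1 (beta : R) u v : 0 <= beta -> phi beta u v <= 1.
Proof.
move=> b0; rewrite /phi -[leRHS](powRr0 (Num.max (enorm R (u - v)) 1)).
by apply: ler_powR; rewrite ?le_max ?lexx ?orbT // oppr_le0.
Qed.

(** [d * K] bounds the Euclidean distance of points that are [near_by K]; the successor also
    dominates the 1 in the maximum that defines [phi]. *)
Definition phi_min (beta : R) (K : nat) : R := (d * K).+1%:R `^ (- beta).

Lemma phi_min_gt0 beta K : 0 < phi_min beta K.
Proof. by apply: powR_gt0; rewrite ltr0n. Qed.

Lemma phi_min_le1 beta K : 0 <= beta -> phi_min beta K <= 1.
Proof.
move=> b0; rewrite /phi_min -[leRHS](powRr0 (d * K).+1%:R).
by apply: ler_powR; rewrite ?ler1n // oppr_le0.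
Qed.

Lemma phi_near beta K u v : 0 <= beta -> near_by K u v ->
  phi_min beta K <= phi beta u v.
Proof.
move=> b0 h; rewrite /phi /phi_min !powRN.
have M1 : 1 <= Num.max (enorm R (u - v)) 1 by rewrite le_max lexx orbT.
rewrite lef_pV2 ?posrE ?powR_gt0 ?(lt_le_trans ltr01 M1) ?ltr0n //.
apply: ge0_ler_powR; rewrite ?nnegrE ?ler0n ?(le_trans ler01 M1) //.
rewrite ge_max ler1n andbT (le_trans (enorm_le_near h)) // ler_nat; lia.
Qed.

End Norm.

(** * A lower bound for the probability of a single choice *)

Section Choice.
Variables (R : realType) (d m n K : nat) (beta : R).
Implicit Types (x : seq 'rV[int]_d) (C : {fset 'rV[int]_d}).

(** A boundary site differs from some point of [P] by a vector with coordinates in {-1, 0, 1}, of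
    which there are [3 ^ d]. *)
Lemma boundary_sub (P : {fset 'rV[int]_d}) : exists2 s : seq 'rV[int]_d,
  (size s <= #|` P| * 3 ^ d)%N & boundary R [set` P] `<=` [set` s].
Proof.
pose V := [seq \row_i ((nat_of_ord (f i))%:Z - 1) | f : {ffun 'I_d -> 'I_3}].
exists [seq y + v | y <- enum_fset P, v <- V].
  by rewrite size_allpairs size_map -cardE card_ffun !card_ord.
move=> z [_ [y [/= yP zy]]].
apply/allpairsP.
exists (y, z - y); split => //=; last by rewrite addrC subrK.
apply/mapP; exists [ffun i => inord (absz ((z - y) 0 i + 1))].
  by rewrite mem_enum.
apply/rowP => i; rewrite [RHS]mxE ffunE.
have := enorm_eq1_coord i zy; move: ((z - y) 0 i) => a ha.
rewrite inordK; lia.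
Qed.

Lemma mem_partial_update C x l y : (y \in partial_update m C x l) =
  (y \notin take m x) && (y \in C) || (y \in drop m (take l x)).
Proof. by rewrite !inE. Qed.

Lemma card_partial_update C x l :
  (#|` partial_update m C x l| <= #|` C| + l)%N.
Proof.
rewrite /partial_update (leq_trans (leq_card_fsetU _ _).1) // leq_add //.
  by rewrite fsubset_leq_card // fsubsetDl.
rewrite card_fseq (leq_trans (size_undup _)) // size_drop size_take_min; lia.
Qed.

Lemma choice_set_sub C x l : (l < 2 * m)%N -> #|` C| = n ->
  exists2 s : seq 'rV[int]_d,
    (size s <= (n + 2 * m) * 3 ^ d)%N & choice_set R m C x l `<=` [set` s].
Proof.
move=> l2 cC; rewrite /choice_set; case: ifP => lm.
  exists (enum_fset C).
    rewrite -[size _]/(#|` C|) cC.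
    by rewrite (leq_trans (leq_addr (2 * m) n)) // leq_pmulr // expn_gt0.
  by move=> z /=; rewrite in_fsetD => /andP[_].
have [s hs hb] := boundary_sub (partial_update m C x l).
exists s => //; apply: (leq_trans hs); rewrite leq_mul2r; apply/orP; right.
by apply: (leq_trans (card_partial_update _ _ _)); rewrite cC leq_add2l ltnW.
Qed.

(** [l = 0] is the uniform choice of x_1; for larger [l], the previous choice sits at position
    [l.-1]. *)
Definition good_choice C x (l : nat) (y : 'rV[int]_d) : Prop :=
  choice_set R m C x l y /\
  [\/ l = 0%N, near_by K (nth 0 x l.-1) y |
    forall y', choice_set R m C x l y' ->
      phi beta (nth 0 x l.-1) y' <= phi beta (nth 0 x l.-1) y].

Definition choice_min : R := phi_min d beta K / ((n + 2 * m) * 3 ^ d).+1%:R.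

Lemma choice_min_gt0 : 0 < choice_min.
Proof. by rewrite divr_gt0 ?phi_min_gt0 // ltr0n. Qed.

Hypothesis beta_ge0 : 0 <= beta.

(** No weight exceeds the weight of the chosen site divided by [phi_min], and the choice set has
    boundedly many elements, so the normalizing sum is at most a constant times that weight. *)
Lemma choice_prob_ge C x l : (l < 2 * m)%N -> #|` C| = n ->
  good_choice C x l (nth 0 x l) -> choice_min <= choice_prob m beta C x l.
Proof.
move=> l2 cC [yS hy]; rewrite /choice_prob mem_set //.
have [s ss sub] := choice_set_sub x l2 cC.
set S := choice_set R m C x l in yS hy sub *.
have fS : finite_set S by apply: sub_finite_set sub _; exact: finite_seq.
set y := nth 0 x l in yS hy *.
have pm0 := phi_min_gt0 d beta K.
have w_ge0 z : 0 <= choice_weight beta x l z.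
  by rewrite /choice_weight; case: (l) => // k; exact: phi_ge0.
(* If [y] is close to the previous choice, its weight is at least [phi_min] while all weights are at
   most 1; if [y] is a maximizer, [phi_min <= 1] is enough. *)
have hw z : S z -> phi_min d beta K * choice_weight beta x l z <=
                   choice_weight beta x l y.
  rewrite /choice_weight; case: (l) hy => [_ _|k hy zS]; first by rewrite mulr1 phi_min_le1.
  case: hy => // [ny|/(_ z zS) hy].
    rewrite (le_trans _ (phi_near beta_ge0 ny)) // ler_piMr ?(ltW pm0) //.
    exact: phi_le1.
  by rewrite (le_trans _ hy) // ler_piMl ?phi_ge0 // phi_min_le1.
have wy : 0 < choice_weight beta x l y.
  rewrite /choice_weight; case: (l) => // k.
  by rewrite powR_gt0 // lt_max ltr01 orbT.
rewrite fsbig_finite //=.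
set T := \sum_(z <- _) _.
have T0 : 0 < T.
  rewrite /T (big_fsetD1 y) /=; last by rewrite in_fset_set // mem_set.
  by rewrite ltr_wpDr // sumr_ge0.
rewrite /choice_min ler_pdivrMr ?ltr0n // mulrAC ler_pdivlMr //.
apply: (@le_trans _ _ (choice_weight beta x l y * (#|` fset_set S|)%:R)).
  apply: (@le_trans _ _ (\sum_(z <- fset_set S) choice_weight beta x l y)).
    rewrite /T mulr_sumr big_seq [leRHS]big_seq; apply: ler_sum => z.
    by rewrite in_fset_set // => /set_mem; exact: hw.
  by rewrite big_const_seq count_predT iter_addr_0 mulr_natr.
rewrite ler_wpM2l // ler_nat ltnW // ltnS (leq_trans _ ss) //.
apply: uniq_leq_size; first exact: fset_uniq.
by move=> z; rewrite in_fset_set // => /set_mem /sub.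
Qed.
End Choice.

(** * Sequences of good choices, and the transitions they realize *)

Section Step.
Variables (R : realType) (d m n K : nat) (beta : R).
Implicit Types (x : seq 'rV[int]_d) (C D : {fset 'rV[int]_d}).

Definition good C x : Prop :=
  forall l, (l < size x)%N -> good_choice m K beta C x l (nth 0 x l).

Lemma choice_set_take C x x' l : take l x = take l x' ->
  choice_set R m C x l = choice_set R m C x' l.
Proof.
move=> e; rewrite /choice_set; case: ltnP => lm; first by rewrite e.
by rewrite /partial_update -(take_takel x lm) -(take_takel x' lm) e.
Qed.

Lemma good_choice_rcons C x l y z : (l <= size x)%N ->
  good_choice m K beta C x l y -> good_choice m K beta C (rcons x z) l y.
Proof.
move=> lx; rewrite /good_choice.
rewrite (@choice_set_take C (rcons x z) x); last first.
  by rewrite -cats1 takel_cat.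
case: l lx => [|l] lx; first by move=> [yS _]; split=> //; exact: Or31.
by rewrite nth_rcons lx.
Qed.

Lemma good_rcons C x y :
  good C x -> good_choice m K beta C x (size x) y -> good C (rcons x y).
Proof.
move=> gx gy l; rewrite size_rcons ltnS leq_eqVlt => /orP[/eqP->|lx].
  by rewrite nth_rcons ltnn eqxx; exact: good_choice_rcons.
by rewrite nth_rcons lx; apply: good_choice_rcons (ltnW lx) (gx _ lx).
Qed.

Lemma good_nil C : good C [::].
Proof. by move=> l. Qed.

Lemma good_uniq C x l : good C x -> (l <= m)%N -> (l <= size x)%N ->
  uniq (take l x) /\ {subset take l x <= C}.
Proof.
move=> gx; elim: l => [|l IH] lm lx; first by rewrite take0.
have [u s] := IH (ltnW lm) (ltnW lx).
have [+ _] := gx _ lx; rewrite /choice_set lm /= !inE /= => /andP[xl xC].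
rewrite (take_nth 0) // rcons_uniq u andbT; split; first exact: xl.
by move=> z; rewrite mem_rcons inE => /orP[/eqP->|/s].
Qed.

(** The first [m] choices are distinct elements of [C], and each later one lies in a boundary, hence
    outside the current set, and adds exactly one element. *)
Lemma card_partial_updateE C x l : good C x -> (m <= l <= size x)%N ->
  #|` partial_update m C x l|%fset = (#|` C| - m + (l - m))%N.
Proof.
move=> gx /andP[]; elim: l => [|l IH].
  rewrite leqn0 => /eqP m0 _; rewrite m0 /partial_update take0 drop0 !subn0 addn0.
  by congr (size (enum_fset _)); apply/fsetP => z; rewrite !inE orbF.
rewrite leq_eqVlt => /orP[/eqP ml|ml] lx.
  have [u s] := good_uniq gx (leqnn m) (leq_trans (eq_leq ml) lx).
  rewrite -ml subnn addn0 /partial_update drop_oversize ?size_take_min ?geq_minl //.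
  have -> : [fset y in [::]]%fset = fset0 :> {fset 'rV[int]_d}.
    by apply/fsetP => z; rewrite !inE.
  rewrite fsetU0 cardfsDS; last by apply/fsubsetP => z; rewrite inE => /s.
  by rewrite card_fseq undup_id // size_takel // ml.
rewrite ltnS in ml.
have [+ _] := gx _ lx; rewrite /choice_set ltnNge ml /= => -[nin _].
have -> : partial_update m C x l.+1 = (nth 0%R x l |` partial_update m C x l)%fset.
  apply/fsetP => z; rewrite /partial_update !inE (take_nth 0) // drop_rcons.
    by rewrite mem_rcons inE orbCA.
  by rewrite size_takel // ltnW.
rewrite cardfsU1 IH // ?(ltnW lx) //.
move/negP: nin; rewrite -/(_ \notin _) => ->.
by rewrite add1n subSn // addnS.
Qed.

(** A transition realized by at least one sequence of good choices, hence of probability bounded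
    below. The size [n] is recorded because the bound depends on it. *)
Definition step C D : Prop :=
  #|` C| = n /\ exists2 x, size x = (2 * m)%N &
    good C x /\ partial_update m C x (2 * m)%N = D.

Lemma step_card C D : (m <= n)%N -> step C D -> #|` D| = n.
Proof.
move=> mn [cC [x sx [gx <-]]]; rewrite card_partial_updateE // ?sx; lia.
Qed.

Definition step_min : R := choice_min d m n K beta ^+ (2 * m).

Lemma step_min_gt0 : 0 < step_min.
Proof. by rewrite exprn_gt0 // choice_min_gt0. Qed.

(** A single term of the sum over choice sequences already gives the bound. *)
Lemma cat_transition_ge C D : 0 <= beta -> step C D ->
  (step_min%:E <= cat_transition m beta C D)%E.
Proof.
move=> b0 [cC [x sx [gx pD]]]; apply: esum_ge.
have sx' : size x == (2 * m)%N by apply/eqP.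
exists [set Tuple sx'].
  by split; [exact: finite_set1|move=> _ -> /=].
rewrite fsbig_set1 lee_fin.
have -> : step_min = \prod_(i < 2 * m) choice_min d m n K beta.
  by rewrite prodr_const card_ord.
apply: ler_prod => i _.
rewrite (ltW (choice_min_gt0 _ _ _ _ _)) /=.
by apply: choice_prob_ge => //; apply: gx; rewrite sx.
Qed.

Fixpoint reach (t : nat) C D : Prop :=
  if t is t'.+1 then exists2 E, step C E & reach t' E D else C = D.

Lemma reach_trans t1 t2 C D E : reach t1 C D -> reach t2 D E ->
  reach (t1 + t2) C E.
Proof.
elim: t1 C => [C ->|t1 IH C [F CF FD] DE] //.
by rewrite addSn; exists F => //; exact: IH.
Qed.

Lemma reach_card t C D : (m <= n)%N -> #|` C| = n -> reach t C D -> #|` D| = n.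
Proof.
move=> mn; elim: t C => [C cC <- //|t IH C cC [E CE ED]].
exact: (IH E (step_card mn CE) ED).
Qed.

End Step.

(** * From paths of good steps to probabilities of trajectories *)

Section Markov.
Variables (R : realType) (dO : measure_display) (Omega : measurableType dO).
Variables (P : probability Omega R) (T : Type) (Ker : T -> T -> \bar R) (c : T).
Variables (X : nat -> Omega -> T).
Hypothesis chain : markov_chain P Ker c X.

Lemma measurable_trajectory (t : nat) (s : nat -> T) :
  measurable [set w | forall i, (i <= t)%N -> X i w = s i].
Proof.
have [mX _ _] := chain.
have -> : [set w | forall i, (i <= t)%N -> X i w = s i] =
    \bigcap_(i in [set i | (i <= t)%N]) (X i @^-1` [set s i]).
  by apply/seteqP; split => w /=.
by apply: bigcap_measurable => [|i _]; [exists 0%N|exact: mX].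
Qed.

Variables (q : R).
Hypothesis q_ge0 : 0 <= q.

Lemma trajectory_extend (j : nat) (s : nat -> T) (a : R) (E : T) :
  0 <= a -> (q%:E <= Ker (s j) E)%E ->
  (a%:E <= P [set w | forall i, (i <= j)%N -> X i w = s i])%E ->
  exists2 s', s' j.+1 = E &
    ((a * q)%:E <= P [set w | forall i, (i <= j.+1)%N -> X i w = s' i])%E.
Proof.
move=> a0 qK aP; have [_ _ mk] := chain.
exists (fun i => if (i <= j)%N then s i else E); first by rewrite ltnn.
rewrite mk leqnn ltnn EFinM; apply: lee_pmul; rewrite ?lee_fin //.
rewrite (_ : [set w | _] = [set w | forall i, (i <= j)%N -> X i w = s i]) //.
by apply/seteqP; split => w /= h i ij; have := h i ij; rewrite ij.
Qed.
End Markov.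

(** The path is followed as one prescribed trajectory, each step contributing a factor [step_min];
    that trajectory is contained in the event that the chain is at [D] at time [t]. *)
Lemma cat_chain_reach (R : realType) (d m n K : nat) (beta : R)
    (dO : measure_display) (Omega : measurableType dO) (P : probability Omega R)
    (C D : {fset 'rV[int]_d}) (X : nat -> Omega -> {fset 'rV[int]_d}) (t : nat) :
  0 <= beta -> cat_chain m beta P C X -> reach m n K beta t C D ->
  ((step_min d m n K beta ^+ t)%:E <= P [set w | X t w = D])%E.
Proof.
move=> b0 [_ ch]; have [mX X0 _] := ch.
set q := step_min _ _ _ _ _; have q0 : 0 <= q by exact/ltW/step_min_gt0.
(* The Markov property concerns whole trajectories from time 0, so the induction carries the past up
   to time [j] along with the [u] steps still to come. *)
have key : forall u j (s : nat -> {fset 'rV[int]_d}) (a : R), 0 <= a ->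
    (a%:E <= P [set w | forall i, (i <= j)%N -> X i w = s i])%E ->
    reach m n K beta u (s j) D -> exists2 s', s' (j + u)%N = D &
      ((a * q ^+ u)%:E <=
       P [set w | forall i, (i <= j + u)%N -> X i w = s' i])%E.
  elim=> [|u IH] j s a a0 aP; first by move=> sD; exists s; rewrite addn0 // expr0 mulr1.
  move=> [E sE ED].
  have [s' s'E as'] := trajectory_extend ch q0 a0
    (cat_transition_ge b0 sE) aP.
  rewrite addnS -addSn exprS mulrA; apply: IH as' _; rewrite ?s'E //.
  exact: mulr_ge0.
move=> CD.
have [|s' s'D h] := key t 0%N (fun=> C) 1 ler01 _ CD.
  rewrite (_ : [set w | _] = [set w | X 0%N w = C]) ?X0 //.
  apply/seteqP; split => w /=; first exact.
  by move=> h i; rewrite leqn0 => /eqP ->.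
rewrite mul1r add0n in h s'D; apply: (le_trans h).
apply: le_measure; rewrite ?inE.
- exact: measurable_trajectory ch _ _.
- exact: (mX t [set D]).
- by move=> w /= /(_ t (leqnn t)) ->.
Qed.

Lemma seq_argmax (dT : Order.disp_t) (T : orderType dT) (A : eqType)
    (f : A -> T) (s : seq A) : s != [::] ->
  exists2 y, y \in s & forall z, z \in s -> (f z <= f y)%O.
Proof.
elim: s => // a s IH _; have [->|/IH[y ys hy]] := eqVneq s [::].
  by exists a; rewrite ?mem_head // => z; rewrite inE => /eqP->.
have [le|lt] := leP (f a) (f y).
  by exists y; rewrite ?inE ?ys ?orbT // => z; rewrite inE => /orP[/eqP->|/hy].
exists a; rewrite ?mem_head // => z; rewrite inE => /orP[/eqP->//|/hy h].
exact: le_trans h (ltW lt).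
Qed.

Lemma fset_sub_card (T : choiceType) (A : {fset T}) (k : nat) :
  (k <= #|` A|)%N -> exists2 B, (B `<=` A)%fset & #|` B|%fset = k.
Proof.
move=> kA; exists [fset v in take k (enum_fset A)]%fset.
  by apply/fsubsetP => v; rewrite inE => /mem_take.
rewrite card_fseq undup_id ?take_uniq ?fset_uniq // size_takel //.
Qed.

(** * Segments and rays in direction e_1 *)

Section Segment.
Variable d : nat.
Local Notation pt := 'rV[int]_d.+1.
Implicit Types (u v w : pt) (i j s : nat).

Definition translate w i : pt := w + e1 d.+1 *+ i.

Lemma translate0 w : translate w 0 = w.
Proof. by rewrite /translate mulr0n addr0. Qed.

Lemma translateD w i j : translate (translate w i) j = translate w (i + j).
Proof. by rewrite /translate mulrnDr addrA. Qed.

Lemma translate_coord0 w i : translate w i 0 0 = w 0 0 + i%:Z.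
Proof. by rewrite /translate mxE mulmxnE mxE eqxx /= mulr1n natz. Qed.

Lemma translate_inj w : injective (translate w).
Proof. by move=> i j /(congr1 (fun v : pt => v 0 0)); rewrite !translate_coord0; lia. Qed.

Lemma translate_near w i : near_by i w (translate w i).
Proof.
move=> k; rewrite /translate mxE mulmxnE mxE; case: (_ == _) => /=; last by rewrite mul0rn; lia.
by rewrite -mulr_natl mulr1; lia.
Qed.

Lemma translate_near_le w i j k : (i <= j)%N -> (j <= i + k)%N ->
  near_by k (translate w i) (translate w j).
Proof.
move=> ij jk; rewrite -(subnKC ij) -translateD.
by apply: near_by_le (translate_near _ _); lia.
Qed.

Lemma enorm_e1 (R : realType) : enorm R (e1 d.+1) = 1.
Proof.
rewrite /enorm big_ord_recl big1 => [|i _]; last by rewrite mxE /= expr0n.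
by rewrite mxE /= addr0 expr1n sqrtr1.
Qed.

Lemma enorm_shift (R : realType) w i : enorm R (translate w i.+1 - translate w i) = 1.
Proof.
by rewrite /translate mulrSr addrA (addrC (w + _)) addrK enorm_e1.
Qed.

Definition segm w s : {fset pt} := [fset v in [seq translate w i | i <- iota 0 s]]%fset.

Lemma segmP w s v :
  reflect (exists2 i, (i < s)%N & v = translate w i) (v \in segm w s).
Proof.
rewrite inE; apply: (iffP mapP) => [[i]|[i si ->]].
  by rewrite mem_iota add0n => /andP[_ si] ->; exists i.
by exists i => //; rewrite mem_iota.
Qed.

Lemma mem_segm w s i : (translate w i \in segm w s) = (i < s)%N.
Proof.
apply/segmP/idP => [[j js /translate_inj->//]|]; by exists i.
Qed.

Lemma card_segm w s : #|` segm w s| = s.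
Proof.
rewrite card_fseq undup_id ?size_map ?size_iota //.
by rewrite map_inj_uniq ?iota_uniq //; exact: translate_inj.
Qed.

Lemma segm_cat w s t : segm w (s + t) = (segm w s `|` segm (translate w s) t)%fset.
Proof.
apply/fsetP => v; rewrite in_fsetU; apply/segmP/orP => [[i ist ->]|].
  have [si|si] := ltnP i s; first by left; rewrite mem_segm.
  by right; apply/segmP; exists (i - s)%N; rewrite ?translateD ?subnKC // ltn_subLR.
case=> /segmP[i si ->]; first by exists i => //; rewrite ltn_addr.
by exists (s + i)%N; rewrite ?ltn_add2l ?translateD.
Qed.

(** A finite set cannot contain the whole ray from [w]. The first site of the ray outside [S]
    follows a site of [S], and the occupied sites before it are distinct, which bounds [i]. *)
Lemma ray_boundary (R : realType) (S : {fset pt}) w : w \in S ->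
  exists2 i, (i <= #|` S|)%N & boundary R [set` S] (translate w i).
Proof.
move=> wS.
have bound j : (forall i, (i < j)%N -> translate w i \in S) -> (j <= #|` S|)%N.
  move=> h; rewrite -(card_segm w j); apply/fsubset_leq_card/fsubsetP => v.
  by move=> /segmP[i /h + ->].
have ex : exists i, translate w i \notin S.
  apply: contrapT => h; suff : (#|` S|.+1 <= #|` S|)%N by rewrite ltnn.
  by apply: bound => i _; apply/negPn/negP => hi; apply: h; exists i.
case: (ex_minnP ex) => -[|i] hi mini; first by rewrite translate0 wS in hi.
have hS j : (j < i.+1)%N -> translate w j \in S.
  by move=> ji; apply/negPn/negP => /mini; rewrite leqNgt ji.
exists i.+1; first exact: bound.
split; first exact/negP.
by exists (translate w i); split; [exact: hS|exact: enorm_shift].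
Qed.

End Segment.

(** * Explicit moves: growing, idling, sliding and aligning segments *)

Section Moves.
Variables (R : realType) (d m n K : nat) (beta : R).
Local Notation pt := 'rV[int]_d.+1.
Local Notation step := (@step R d.+1 m n K beta).
Local Notation reach := (@reach R d.+1 m n K beta).
Implicit Types (C E X A : {fset pt}) (u v w : pt).

(** [xs] is activated and [ys] is then filled in order. The unactivated site [z] supports the first
    new particle and each new particle supports the next one, so every target is in the boundary
    when it is chosen. *)
Lemma step_move C (xs ys : seq pt) z : #|` C| = n ->
  size xs = m -> size ys = m -> uniq xs -> {subset xs <= C} ->
  (forall u v, u \in xs ++ ys -> v \in xs ++ ys -> near_by K u v) ->
  z \in C -> z \notin xs ->
  path (fun u v => enorm R (v - u) == 1) z ys -> uniq ys ->
  (forall v, v \in ys -> v \in C -> v \in xs) ->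
  step C ((C `\` [fset v in xs]) `|` [fset v in ys])%fset.
Proof.
move=> cC sx sy ux xC nr zC zx py uy yC; split => //.
exists (xs ++ ys); first by rewrite size_cat sx sy; lia.
split; last first.
  rewrite /partial_update (@take_oversize _ (2 * m)) ?size_cat ?sx ?sy ?addnn ?mul2n //.
  by rewrite take_size_cat // drop_size_cat.
move=> l; rewrite size_cat sx sy => lm; split; last first.
  case: l lm => [|l] lm; first exact: Or31.
  by apply: Or32; apply: nr; rewrite mem_nth // size_cat sx sy //= ltnW.
rewrite /choice_set; case: ltnP => ml /=.
  rewrite nth_cat sx ml in_fsetD inE takel_cat ?sx ?(ltnW ml) //.
  rewrite xC ?mem_nth ?sx // andbT.
  by apply/negP => /(nthP 0)[i]; rewrite size_takel ?sx ?(ltnW ml) // => il;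
    rewrite nth_take // => /eqP; rewrite nth_uniq ?sx ?(ltn_trans il) // => /eqP E;
    rewrite E ltnn in il.
have lt : (l - m < m)%N by lia.
rewrite nth_cat sx ltnNge ml /=.
have -> : partial_update m C (xs ++ ys) l =
    ((C `\` [fset v in xs]) `|` [fset v in take (l - m) ys])%fset.
  rewrite /partial_update take_size_cat // take_cat sx ltnNge ml /=.
  by rewrite drop_size_cat.
split.
  rewrite /= !inE => /orP[/andP[/negP h /yC]|].
    by rewrite mem_nth ?sy // => /(_ isT).
  by move=> /(nthP 0)[i]; rewrite size_takel ?sy ?(ltnW lt) // => il;
    rewrite nth_take // => /eqP; rewrite nth_uniq ?sy ?(ltn_trans il) // => /eqP E;
    rewrite E ltnn in il.
(* The prefix [z] shifts indices by one: this entry is the predecessor of the target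
   [nth 0 ys (l - m)]. *)
exists (nth 0 (z :: ys) (l - m)); split.
  rewrite /= !inE; case: (l - m)%N lt => [|k] lt /=; first by rewrite zx zC.
  apply/orP; right; rewrite -(@nth_take k.+1) // mem_nth //.
  by rewrite size_takel // sy ltnW.
by have /(pathP 0)/(_ (l - m)%N) := py; rewrite sy => /(_ lt)/eqP.
Qed.

Lemma path_shift w i k :
  path (fun u v => enorm R (v - u) == 1) (translate w i)
    [seq translate w j | j <- iota i.+1 k].
Proof. by elim: k i => //= k IH i; rewrite enorm_shift eqxx IH. Qed.

Lemma path_shift_rev w k :
  path (fun u v => enorm R (v - u) == 1) (translate w k)
    (rev [seq translate w j | j <- iota 0 k]).
Proof.
elim: k => // k IH.
rewrite -[k.+1]addn1 iotaD map_cat rev_cat /= IH andbT.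
by rewrite -enormN opprB addn1 enorm_shift.
Qed.

(** Activated points are within [k] of [w] and new sites within [s + m], so any two choices are at
    distance at most twice the sum. The last site of the segment, which exists as [1 <= s], supports
    the first new one. *)
Lemma step_grow E X w s k : #|` (E `|` X `|` segm w s)%fset| = n ->
  #|` X| = m -> (1 <= s)%N -> (2 * (k + (s + m)) <= K)%N ->
  (forall u, u \in X -> (u \notin E) && (u \notin segm w s)) ->
  (forall u, u \in X -> near_by k u w) ->
  (forall i, (i < s + m)%N -> translate w i \notin E) ->
  step (E `|` X `|` segm w s)%fset (E `|` segm w (s + m))%fset.
Proof.
move=> cC cX s0 leK dX nX dE.
pose xs : seq pt := enum_fset X.
pose ys := [seq translate w i | i <- iota s m].
have ysP v : v \in ys -> exists2 i, (s <= i < s + m)%N & v = translate w i.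
  by move=> /mapP[i]; rewrite mem_iota => ? ->; exists i.
have nr u : u \in xs ++ ys -> near_by (k + (s + m)) u w.
  rewrite mem_cat => /orP[/nX|/ysP[i /andP[_ im] ->]].
    by apply: near_by_le; rewrite leq_addr.
  by apply: near_by_sym; apply: near_by_le (translate_near w i); lia.
have -> : (E `|` segm w (s + m) = ((E `|` X `|` segm w s) `\`
    [fset v in xs]) `|` [fset v in ys])%fset.
  rewrite segm_cat.
  have -> : segm (translate w s) m = [fset v in ys]%fset.
    apply/fsetP => v; transitivity (v \in ys); last by rewrite inE.
    apply/segmP/mapP => -[i].
      by exists (s + i)%N; rewrite ?mem_iota -?translateD //; lia.
    rewrite mem_iota => ? ->; exists (i - s)%N; first by lia.
    by rewrite translateD subnKC //; lia.
  have -> : [fset v in xs]%fset = X by apply/fsetP => v; rewrite inE.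
  rewrite fsetUA; congr (_ `|` _)%fset; apply/fsetP => v.
  rewrite !(in_fsetU, in_fsetD).
  have := dX v; case: (v \in X) => //=.
    by move=> /(_ isT)/andP[/negPf-> /negPf->].
  by rewrite orbF.
apply: (@step_move _ xs ys (translate w s.-1)) => //.
- by rewrite size_map size_iota.
- by rewrite fset_uniq.
- by move=> v vX; rewrite !in_fsetU vX orbT.
- move=> u v /nr hu /nr hv; apply: near_by_trans hu (near_by_sym hv); lia.
- by rewrite in_fsetU mem_segm prednK // leqnn orbT.
- apply/negP => /dX; rewrite mem_segm prednK // leqnn andbF //.
- by have := path_shift w s.-1 m; rewrite prednK.
- by rewrite map_inj_uniq ?iota_uniq //; exact: translate_inj.
- move=> v /ysP[i /andP[si im] ->]; rewrite !in_fsetU mem_segm (negPf (dE i im)).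
  by rewrite ltnNge si orbF.
Qed.

(* Activated from left to right and put back in the reverse order, so that each
   site is again in the boundary when it is chosen. *)
Lemma step_lazy C w s : #|` C| = n -> (m < s)%N -> (2 * m <= K)%N ->
  (segm w s `<=` C)%fset -> step C C.
Proof.
move=> cC ms mK /fsubsetP sC.
pose xs := [seq translate w i | i <- iota 0 m].
have xsP v : v \in xs -> exists2 i, (i < m)%N & v = translate w i.
  by move=> /mapP[i]; rewrite mem_iota => /andP[_ ?] ->; exists i.
have xsC v : v \in xs -> v \in C.
  by move=> /xsP[i im ->]; apply: sC; rewrite mem_segm (ltn_trans im).
have sz : size xs = m by rewrite size_map size_iota.
have ux : uniq xs by rewrite map_inj_uniq ?iota_uniq //; exact: translate_inj.
have {2}-> : (C = (C `\` [fset v in xs]) `|` [fset v in rev xs])%fset.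
  apply/fsetP => v; rewrite !inE mem_rev.
  by case: (boolP (v \in xs)) => [/xsC->|_]; rewrite ?orbT ?orbF.
apply: (@step_move _ _ _ (translate w m)) => //; rewrite ?size_rev ?rev_uniq //.
- move=> u v; rewrite !mem_cat !mem_rev !orbb => /xsP[i im ->] /xsP[j jm ->].
  apply: near_by_trans (near_by_sym (translate_near w i)) (translate_near w j); lia.
- by apply: sC; rewrite mem_segm.
- by apply/negP => /xsP[i im /translate_inj mi]; rewrite mi ltnn in im.
- exact: path_shift_rev.
- by move=> v; rewrite mem_rev.
Qed.

(** Each step moves the [m] leftmost sites of the segment to its right end; [m < s] leaves a
    nonempty piece to which they attach. *)
Lemma reach_slide E w s t : (m <= n)%N -> (m < s)%N -> (4 * m + 2 * s <= K)%N ->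
  #|` (E `|` segm w s)%fset| = n ->
  (forall i, (i < t * m + s)%N -> translate w i \notin E) ->
  reach t (E `|` segm w s)%fset (E `|` segm (translate w (t * m)) s)%fset.
Proof.
move=> mn ms sK; elim: t w => [|t IH] w cC dE; first by rewrite mul0n translate0.
have st : step (E `|` segm w s)%fset (E `|` segm (translate w m) s)%fset.
  have e : (E `|` segm w s = E `|` segm w m `|` segm (translate w m) (s - m))%fset.
    by rewrite -fsetUA -segm_cat subnKC // ltnW.
  have {2}-> : s = (s - m + m)%N by rewrite subnK // ltnW.
  rewrite e; apply: (@step_grow _ _ _ _ m).
  - by rewrite -e.
  - exact: card_segm.
  - by rewrite subn_gt0.
  - lia.
  - move=> u /segmP[i im ->]; rewrite dE /=; last by lia.
    apply/segmP => -[j jm]; rewrite translateD => /translate_inj; lia.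
  - by move=> u /segmP[i im ->]; apply: translate_near_le; lia.
  - by move=> i im; rewrite translateD dE //; lia.
exists (E `|` segm (translate w m) s)%fset => //.
rewrite mulSn -translateD; apply: IH; first exact: step_card mn st.
by move=> i it; rewrite translateD dE // mulSn; lia.
Qed.

(* The second step also moves the leftmost elements of the segment built by the
   first one, when less than m elements of A remain outside it. *)
Lemma reach_align E A y k : (m <= n)%N -> #|` (E `|` A)%fset| = n ->
  (m + 1 <= #|` A| <= 2 * m + 1)%N -> (2 * (k + 4 * m + 2) <= K)%N -> y \in A ->
  (forall u, u \in A -> u \notin E) ->
  (forall u, u \in A -> near_by k u y /\ u 0 0 <= y 0 0) ->
  (forall i, (i <= 2 * m)%N -> translate y i \notin E) ->
  reach 2 (E `|` A)%fset
    (E `|` segm (translate y (2 * m + 1 - #|` A|)) #|` A|)%fset.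
Proof.
move=> mn cC /andP[mA Am] leK yA dA nA dE.
have cAy : #|` (A `\ y)%fset| = (#|` A|).-1 by rewrite (cardfsD1 y A) yA.
have [X XA cX] : exists2 X, (X `<=` A `\ y)%fset & #|` X| = m.
  by apply: fset_sub_card; rewrite cAy; lia.
have XAP u : u \in X -> u != y /\ u \in A.
  by move=> /(fsubsetP XA); rewrite !inE => /andP[].
pose B := (A `\ y `\` X)%fset.
have cB : #|` B| = (#|` A| - m - 1)%N by rewrite cardfsDS // cAy cX; lia.
have BP u : u \in B -> [/\ u != y, u \in A & u \notin X].
  by rewrite !inE => /and3P[].
have eA : (E `|` A = (E `|` B) `|` X `|` segm y 1)%fset.
  apply/fsetP => v; rewrite !(in_fsetU, in_fsetD, in_fset1).
  have -> : (v \in segm y 1) = (v == y).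
    apply/segmP/eqP => [[[|i] //= _ ->]|->]; first by rewrite translate0.
    by exists 0%N; rewrite ?translate0.
  have [->|_] := eqVneq v y; first by rewrite yA !orbT.
  have := XAP v; case: (v \in X) => /=; first by move=> /(_ isT)[_ ->]; rewrite !orbT.
  by rewrite !orbF.
have yB i : translate y i \notin B.
  apply/negP => /BP[+ /nA[_ le] _]; rewrite translate_coord0 in le.
  by case: i le => [|i] le; [rewrite translate0 eqxx|move=> _; exfalso; move: le; set a := y 0 0; lia].
have st1 : step (E `|` A)%fset (E `|` B `|` segm y (1 + m))%fset.
  rewrite eA; apply: (@step_grow _ _ _ _ k) => //.
  - by rewrite -eA.
  - lia.
  - move=> u uX; have [uy uA] := XAP u uX.
    rewrite in_fsetU negb_or dA //=; apply/andP; split.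
      by apply/negP => /BP[_ _]; rewrite uX.
    by apply/segmP => -[[|i] //= _ uE]; rewrite uE translate0 eqxx in uy.
  - by move=> u /XAP[_ /nA[]].
  - move=> i im; rewrite in_fsetU negb_or yB dE //; lia.
exists (E `|` B `|` segm y (1 + m))%fset => //.
(* The [b] leftover points of [A] are completed to [m] activated ones by the [m - b] leftmost sites;
   the remaining [1 + b] sites start at [w] and grow to [1 + b + m], the size of [A]. *)
set b := #|` B| in cB; pose w := translate y (m - b).
have eB : (E `|` B `|` segm y (1 + m) =
           E `|` (B `|` segm y (m - b)) `|` segm w (1 + b))%fset.
  rewrite -!fsetUA -segm_cat; do 2 congr (_ `|` _)%fset.
  congr segm; clearbody b; lia.
have eW : (2 * m + 1 - #|` A| = m - b)%N by lia.
have eS : #|` A| = (1 + b + m)%N by lia.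
rewrite eW {1}eS -/w; exists (E `|` segm w (1 + b + m))%fset; last first.
  by rewrite -eS.
rewrite eB; apply: (@step_grow _ _ _ _ (k + m)) => //.
- by rewrite -eB; exact: step_card mn st1.
- rewrite cardfsU card_segm.
  have -> : (B `&` segm y (m - b) = fset0)%fset.
    apply/fsetP => v; rewrite in_fsetI in_fset0; apply/negP => /andP[vB /segmP[i _ vi]].
    by rewrite vi (negPf (yB i)) in vB.
  rewrite cardfs0 -/b; lia.
- lia.
- move=> u; rewrite in_fsetU => /orP[uB|/segmP[i im ->]].
    have [_ uA _] := BP u uB; rewrite dA //=; apply/segmP => -[i _].
    by rewrite translateD => uE; rewrite uE (negPf (yB _)) in uB.
  rewrite dE /=; last by lia.
  by apply/segmP => -[j _]; rewrite translateD => /translate_inj; lia.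
- move=> u; rewrite in_fsetU => /orP[/BP[_ /nA[ny _] _]|/segmP[i im ->]].
    by apply: near_by_trans ny (translate_near y _); lia.
  by apply: translate_near_le; lia.
- by move=> i im; rewrite translateD dE //; lia.
Qed.

End Moves.

(** * Gathering: merging small parts until every part has more than [m] elements *)

Section Gather.
Variables (R : realType) (d m n K : nat) (beta : R).
Hypothesis mn : (m < n)%N.
Hypothesis m_gt0 : (0 < m)%N.
Local Notation pt := 'rV[int]_d.+1.
Local Notation step := (@step R d.+1 m n K beta).
Local Notation reach := (@reach R d.+1 m n K beta).
Local Notation good := (@good R d.+1 m K beta).
Local Notation good_choice := (@good_choice R d.+1 m K beta).
Implicit Types (C E X A U : {fset pt}) (u v w a z : pt) (x : seq pt).

(** Parts are encoded as level sets of a labelling [f], so that merging parts amounts to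
    relabelling. *)
Definition fiber U (f : pt -> pt) a : {fset pt} := [fset v in U | f v == f a]%fset.

Lemma fiberP U f a v : (v \in fiber U f a) = (v \in U) && (f v == f a).
Proof. by rewrite !inE. Qed.

Lemma greedy_choice C x l : (l < 2 * m)%N -> #|` C| = n ->
  choice_set R m C x l !=set0 -> exists y, good_choice C x l y.
Proof.
move=> l2 cC [y0 y0S]; have [s _ sub] := choice_set_sub R x l2 cC.
have fS : finite_set (choice_set R m C x l).
  by apply: sub_finite_set sub _; exact: finite_seq.
have [|y yS hy] := @seq_argmax _ R _ (phi beta (nth 0 x l.-1))
    (fset_set (choice_set R m C x l)).
  apply/eqP => e; have : y0 \in fset_set (choice_set R m C x l).
    by rewrite in_fset_set // mem_set.
  by rewrite -[_ \in _]/(y0 \in enum_fset _) e.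
exists y; split; first by move: yS; rewrite in_fset_set // => /set_mem.
by apply: Or33 => z zS; apply: hy; rewrite in_fset_set // mem_set.
Qed.

(** At most [m < n] particles have been removed, so one remains, and the ray from it meets the
    boundary. *)
Lemma choice_set_neq0 C x l : #|` C| = n -> (l <= m)%N ->
  choice_set R m C x l !=set0.
Proof.
move=> cC lm.
have ne k : (k <= m)%N -> exists y, y \in (C `\` [fset v in take k x])%fset.
  move=> km; apply/fset0Pn; rewrite -cardfs_gt0.
  have : (#|` C| <= #|` (C `\` [fset v in take k x])%fset| + k)%N.
    rewrite -(cardfsID [fset v in take k x]%fset C) addnC leq_add2l.
    apply: (leq_trans (fsubset_leq_card (fsubsetIr _ _))).
    rewrite card_fseq (leq_trans (size_undup _)) // size_take_min geq_minl //.
  lia.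
rewrite /choice_set; case: ltnP => ml; first by have [y yC] := ne l lm; exists y.
have [y yC] := ne m (leqnn m).
have yP : y \in partial_update m C x l.
  by rewrite /partial_update in_fsetU yC.
have [i _ ib] := ray_boundary R yP; by exists (translate y i).
Qed.

Lemma extend_greedy C x l : #|` C| = n -> good C x ->
  (size x <= l <= m.+1)%N ->
  exists x', [/\ good C x', size x' = l & take (size x) x' = x].
Proof.
move=> cC gx /andP[]; elim: l => [|l IH].
  rewrite leqn0 => /eqP s0 _; by exists x; split=> //; rewrite take_size.
rewrite leq_eqVlt => /orP[/eqP e|sl] lm.
  by exists x; split => //; rewrite take_size.
have [x' [gx' sx' tx']] := IH sl (ltnW lm).
have l2 : (l < 2 * m)%N by lia.
have [y gy] := greedy_choice l2 cC (choice_set_neq0 x' cC lm).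
exists (rcons x' y); split.
- by apply: good_rcons => //; rewrite sx'.
- by rewrite size_rcons sx'.
- by rewrite -cats1 takel_cat // sx'.
Qed.

(** Consecutive choices stay in [A], where all points are close, so any order of activation is
    good. *)
Lemma good_enum C A x : (A `<=` C)%fset ->
  {in A &, forall u v, near_by K u v} -> (size x <= m)%N ->
  uniq x -> {subset x <= A} -> good C x.
Proof.
move=> /fsubsetP AC nA; elim/last_ind: x => [|x y IH]; first by move=> *; exact: good_nil.
rewrite size_rcons rcons_uniq => sm /andP[yx ux] sub.
have yA : y \in A by apply: sub; rewrite mem_rcons mem_head.
have xA : {subset x <= A} by move=> v vx; apply: sub; rewrite mem_rcons inE vx orbT.
apply: good_rcons; first exact: IH (ltnW sm) _ _.
split.
  rewrite /choice_set sm /= take_size in_fsetD AC // andbT.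
  by rewrite inE.
case: x {IH sm yx ux sub} xA => [|v x] xA; first exact: Or31.
by apply: Or32; apply: nA => //; apply: xA; rewrite mem_nth.
Qed.

(* Each further choice is the first free site in direction e_1 from the previous
   one, which is occupied, hence it is at distance at most n + 2m. *)
Lemma extend_ray C x z l : #|` C| = n -> good C x -> (size x = m.+1)%N ->
  (n + 2 * m <= K)%N ->
  near_by 1 z (nth 0 x m) -> (m < l <= 2 * m)%N ->
  exists x', [/\ good C x', size x' = l, take m x' = take m x &
    forall v, v \in drop m x' -> near_by (1 + (l - m.+1) * (n + 2 * m)) z v].
Proof.
move=> cC gx sx nK nz /andP[]; elim: l => // l IH; rewrite ltnS leq_eqVlt.
move=> /orP[/eqP ml|ml] lm.
  exists x; split => //; first by rewrite sx ml.
  have -> : drop m x = [:: nth 0 x m] by rewrite (drop_nth 0) ?drop_oversize ?sx.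
  by move=> v; rewrite inE -ml subnn mul0n addn0 => /eqP->.
have [x' [gx' sx' tx' nx']] := IH ml (ltnW lm).
have l2 : (l < 2 * m)%N by lia.
set u := nth 0 x' l.-1.
have ud : u \in drop m x'.
  have -> : u = nth 0 (drop m x') (l.-1 - m) by rewrite nth_drop subnKC //; lia.
  by rewrite mem_nth // size_drop sx'; lia.
have uP : u \in partial_update m C x' l.
  by rewrite mem_partial_update -sx' take_size ud orbT.
have [i iS ib] := ray_boundary R uP.
have iK : (i <= n + 2 * m)%N.
  apply: (leq_trans iS); apply: (leq_trans (card_partial_update _ _ _ _)).
  by rewrite cC; lia.
exists (rcons x' (translate u i)); split.
- apply: good_rcons => //; rewrite sx'; split.
    by rewrite /choice_set ltnNge (ltnW ml).
  by apply: Or32; apply: near_by_le (translate_near u i); lia.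
- by rewrite size_rcons sx'.
- by rewrite -cats1 takel_cat // sx' ltnW.
- move=> v; rewrite drop_rcons ?sx' 1?ltnW // mem_rcons inE => /orP[/eqP->|/nx'].
    apply: near_by_trans (nx' _ ud) (near_by_le iK (translate_near u i)).
    by rewrite subSS -addnA leq_add2l -mulSnr; apply: leq_mul => //; lia.
  by apply: near_by_le; rewrite leq_add2l leq_mul2r; apply/orP; right; lia.
Qed.

(** Twice the radius about [z] that [extend_ray] gives at [l = 2 * m], with [m - 1] rounded up to
    [m]. *)
Definition spread_step := (2 * (1 + m * (n + 2 * m)))%N.

(** The fiber of [a] has at most [m] elements, so all of it is activated, possibly with points of
    other parts. All transported points take the label of [z]; the label [f a] disappears and no new
    label arises. *)
Lemma merge_small C f a k : #|` C| = n -> a \in C -> (#|` fiber C f a| <= m)%N ->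
  (k <= K)%N -> (n + 2 * m <= K)%N ->
  {in C &, forall u v, f u = f v -> near_by k u v} ->
  exists C' (f' : pt -> pt), [/\ step C C',
    {in C' &, forall u v, f' u = f' v -> near_by (k + spread_step) u v} &
    (#|` (f' @` C')%fset| < #|` (f @` C)%fset|)%N].
Proof.
move=> cC aC cA kK nK nf.
have AC : (fiber C f a `<=` C)%fset by apply/fsubsetP => v; rewrite fiberP => /andP[].
have g0 : good C (enum_fset (fiber C f a)).
  apply: (@good_enum C (fiber C f a)) => //; last exact: fset_uniq.
  move=> u v; rewrite !fiberP => /andP[uC /eqP fu] /andP[vC /eqP fv].
  by apply: near_by_le kK (nf _ _ uC vC _); rewrite fu.
have [|x0 [gx0 sx0 tx0]] := @extend_greedy _ _ m.+1 cC g0.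
  by rewrite leqnn andbT (leq_trans cA).
(* Position [m] holds the first transported particle; being in the boundary, it has a neighbour [z]
   among the particles not activated. *)
have [+ _] := gx0 m (leq_trans (leqnn _) (eq_leq (esym sx0))).
rewrite /choice_set ltnn => -[_ [z [/= zP zn]]].
have nz : near_by 1 z (nth 0 x0 m).
  apply: near_by_sym => i; have := enorm_eq1_coord i zn.
  by rewrite !mxE.
have zC : z \in C /\ z \notin take m x0.
  move: zP; rewrite mem_partial_update drop_oversize ?size_take_min ?geq_minl //.
  by rewrite in_nil orbF => /andP[].
have [|x [gx sx tx nx]] := @extend_ray _ _ z (2 * m) cC gx0 sx0 nK nz.
  by lia.
pose Y := drop m x.
have zY v : v \in Y -> near_by (1 + m * (n + 2 * m)) z v.
  move=> /nx; apply: near_by_le; rewrite leq_add2l leq_mul2r; apply/orP; right; lia.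
pose f' v := if v \in Y then f z else f v.
have Ax v : v \in fiber C f a -> v \in take m x0.
  move=> vA; have : v \in take (#|` fiber C f a|) x0 by rewrite tx0.
  have -> : take #|` fiber C f a| x0 = take #|` fiber C f a| (take m x0).
    by rewrite take_takel.
  by move=> /mem_take.
have C'P v : v \in partial_update m C x (2 * m) ->
    v \in Y \/ [/\ v \notin Y, v \in C & v \notin take m x0].
  rewrite mem_partial_update (@take_oversize _ (2 * m)) ?sx // tx => /orP[|vY]; last by left.
  case: (boolP (v \in Y)) => vY; [by left|move=> /andP[? ?]; by right].
exists (partial_update m C x (2 * m)), f'; split.
- by split=> //; exists x.
- have mixed u v : u \in Y -> v \in C -> f z = f v -> near_by (k + spread_step) u v.
    move=> /zY zu vC /nf zv; apply: near_by_trans (near_by_sym zu) (zv zC.1 vC).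
    rewrite /spread_step; lia.
  move=> u v uC vC; rewrite /f'.
  case: (C'P _ uC) => [uY|[/negPf uY uC0 _]]; rewrite uY.
    case: (C'P _ vC) => [vY|[/negPf vY vC0 _]]; rewrite vY.
      move=> _; apply: near_by_trans (near_by_sym (zY _ uY)) (zY _ vY).
      rewrite /spread_step; lia.
    exact: mixed.
  case: (C'P _ vC) => [vY|[/negPf vY vC0 _]]; rewrite vY => fuv.
    by apply: near_by_sym; exact: mixed.
  by apply: near_by_le (nf _ _ uC0 vC0 fuv); rewrite leq_addr.
- have fa : f a \in (f @` C)%fset by apply: in_imfset.
  rewrite [ltnRHS](cardfsD1 (f a)) fa add1n ltnS.
  apply/fsubset_leq_card/fsubsetP => b /imfsetP[v /= vC' ->].
  (* A point that was not activated is outside the fiber of [a], hence has another label; this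
     covers [z] too. *)
  have hz u : u \in C -> u \notin take m x0 -> f u \in (f @` C `\ f a)%fset.
    move=> uC ux; rewrite in_fsetD1 in_imfset // andbT.
    by apply: contra ux => fua; apply: Ax; rewrite fiberP uC.
  rewrite /f'; case: (C'P _ vC') => [->|[/negPf -> vC vx]]; last exact: hz.
  exact: hz zC.1 zC.2.
Qed.

(** Each merge lowers the number of labels, so [J] bounds the number of merges, and each adds
    [spread_step] to the diameter bound. *)
Lemma gather C (f : pt -> pt) k J kmax : #|` C| = n -> (#|` (f @` C)%fset| <= J)%N ->
  (k + J * spread_step <= kmax)%N -> (kmax <= K)%N -> (n + 2 * m <= K)%N ->
  {in C &, forall u v, f u = f v -> near_by k u v} ->
  exists t C' (f' : pt -> pt), [/\ (t <= J)%N, reach t C C',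
    {in C' &, forall u v, f' u = f' v -> near_by kmax u v} &
    {in C', forall a, (m < #|` fiber C' f' a|)%N}].
Proof.
move=> + + + kK nK.
elim: J C f k => [|J IH] C f k cC cJ kJ nf.
  exists 0%N, C, f; split => // [u v uC vC /nf h|a aC].
    by apply: near_by_le (h uC vC); lia.
  have : f a \in (f @` C)%fset by apply: in_imfset.
  by move: cJ; rewrite leqn0 cardfs_eq0 => /eqP->; rewrite in_fset0.
have [[a aC cA]|h] := pselect (exists2 a, a \in C & (#|` fiber C f a| <= m)%N).
  have [|C' [f' [CC' nf' lt]]] := @merge_small C f a k cC aC cA _ nK nf.
    lia.
  have [|||t [C'' [f'' [tJ r n'' c'']]]] := IH C' f' _ _ _ _ nf'.
  - exact: step_card (ltnW mn) CC'.
  - by rewrite -ltnS (leq_trans lt).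
  - move: kJ; rewrite mulSn; lia.
  exists t.+1, C'', f''; split => //; by exists C'.
exists 0%N, C, f; split => // [u v uC vC /nf h'|a aC].
  by apply: near_by_le (h' uC vC); lia.
by rewrite ltnNge; apply/negP => cA; apply: h; exists a.
Qed.

End Gather.

(** * Spreading: turning the parts into segments at mutual distance at least [r] *)

Section Spread.
Variables (d m : nat).
Local Notation pt := 'rV[int]_d.+1.
Implicit Types (A C D E S U V : {fset pt}) (u v w x y : pt) (Vs : seq {fset pt}).

Definition spread (r : nat) Vs : Prop :=
  (forall V, V \in Vs -> exists w s, V = segm w s /\ (m < s <= 2 * m + 1)%N) /\
  (forall i j, (i < j < size Vs)%N -> forall x y, x \in nth fset0 Vs i ->
     y \in nth fset0 Vs j -> x 0 0 + r%:Z <= y 0 0).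

Definition covers S Vs : Prop := forall v, (v \in S) = has (fun V => v \in V) Vs.

Lemma spread_cons r V Vs w s : V = segm w s -> (m < s <= 2 * m + 1)%N ->
  (forall W x y, W \in Vs -> x \in V -> y \in W -> x 0 0 + r%:Z <= y 0 0) ->
  spread r Vs -> spread r (V :: Vs).
Proof.
move=> eV hs hV [h1 h2]; split => [W|[|i] [|j]] //=.
- by rewrite inE => /orP[/eqP->|/h1 //]; exists w, s.
- by rewrite ltnS => jV x y xV yW; apply: hV xV yW; rewrite mem_nth.
- by rewrite !ltnS; exact: h2.
Qed.

Lemma segments_segm w s : (0 < s)%N -> segments [set` segm w s].
Proof.
move=> s0; exists s, (w - e1 d.+1); split => //.
apply/seteqP; split => v /=.
  move=> /segmP[i si ->]; exists i.+1 => //.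
  by rewrite mulrS addrA subrK.
move=> [[|i] //= si <-]; apply/segmP; exists i => //.
by rewrite mulrS addrA subrK.
Qed.

(** A gap in the first coordinate bounds the Euclidean distance from below, and a positive gap makes
    the segments disjoint. *)
Lemma spread_CanPersist (R : realType) r S Vs : (0 < r)%N ->
  covers S Vs -> spread r Vs -> (m + 1 <= #|` S|)%N ->
  CanPersist m (r%:R : R) S.
Proof.
move=> r0 cS [hV sV] mS; split => //.
exists (size Vs), (fun j : 'I_(size Vs) => nth fset0 Vs j).
have far (i j : 'I_(size Vs)) x y : i != j -> x \in nth fset0 Vs i ->
    y \in nth fset0 Vs j -> r%:Z <= `|x 0 0 - y 0 0|.
  rewrite neq_ltn => /orP[ij|ij] xi yj.
    by have := sV i j; rewrite ij ltn_ord => /(_ isT x y xi yj); lia.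
  by have := sV j i; rewrite ij ltn_ord => /(_ isT y x yj xi); lia.
split.
- move=> j; have [|w [s [-> /andP[ms _]]]] := hV (nth fset0 Vs j).
    by rewrite mem_nth.
  by rewrite -cardfs_gt0 card_segm (leq_trans _ ms).
- move=> i j ij; apply/fdisjointP => x xi; apply/negP => xj.
  by have := far i j x x ij xi xj; rewrite subrr normr0; lia.
- apply/seteqP; split => v /=.
    rewrite cS => /(has_nthP fset0)[i iV vi].
    by exists (Ordinal iV).
  by move=> [i _ vi]; rewrite cS; apply/(has_nthP fset0); exists i.
- move=> j; have [|w [s [eV /andP[ms sm]]]] := hV (nth fset0 Vs j).
    by rewrite mem_nth.
  split.
  + by rewrite eV; apply: segments_segm; rewrite (leq_trans _ ms).
  + by rewrite eV card_segm addn1 ms.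
  + apply: le_ereal_inf_tmp => _ [x /= xj [y [i /= ij yi] <-]].
    rewrite lee_fin; apply: le_trans (coord_le_enorm _ _ 0).
    rewrite -intr_norm -[leLHS]/((r%:Z)%:~R) ler_int !mxE.
    by apply: far xj yi; rewrite eq_sym.
Qed.

Lemma fiber_setD U A f a y : (A `<=` fiber U f y)%fset -> f a != f y ->
  fiber (U `\` A)%fset f a = fiber U f a.
Proof.
move=> /fsubsetP AF ay; apply/fsetP => v; rewrite !fiberP in_fsetD.
have [vA|//] := boolP (v \in A).
have := AF v vA; rewrite fiberP => /andP[_ /eqP->].
by rewrite eq_sym (negPf ay) !andbF.
Qed.

(** A fiber with at most [2 * m + 1] elements is taken whole; from a larger one, [y] and [m] others
    are taken, which leaves at least [m + 1]. *)
Lemma fiber_part U (f : pt -> pt) y : y \in U ->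
  {in U, forall a, (m < #|` fiber U f a|)%N} ->
  exists A, [/\ (A `<=` fiber U f y)%fset, y \in A,
    (m + 1 <= #|` A| <= 2 * m + 1)%N &
    {in (U `\` A)%fset, forall a, (m < #|` fiber (U `\` A)%fset f a|)%N}].
Proof.
move=> yU big; set F := fiber U f y.
have yF : y \in F by rewrite fiberP yU eqxx.
have mF : (m < #|` F|)%N by exact: big.
have [Fm|Fm] := leqP #|` F| (2 * m + 1).
  exists F; split => //; first by rewrite addn1 mF.
  move=> a; rewrite in_fsetD => /andP[aF aU].
  rewrite (@fiber_setD U F f a y) //; first exact: big.
  by apply: contra aF => fa; rewrite fiberP aU.
have [|B BF cB] := @fset_sub_card _ (F `\ y)%fset m.
  by move: mF; rewrite (cardfsD1 y F) yF.
have yB : y \notin B by apply/negP => /(fsubsetP BF); rewrite !inE eqxx.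
have AF : (y |` B `<=` F)%fset.
  by rewrite fsubUset fsub1set yF (fsubset_trans BF) // fsubsetDl.
have cA : #|` (y |` B)%fset| = m.+1 by rewrite cardfsU1 yB cB.
exists (y |` B)%fset; split => //; first by rewrite fset1U1.
  by rewrite cA; lia.
move=> a; rewrite in_fsetD => /andP[aA aU].
have [fa|fa] := eqVneq (f a) (f y); last first.
  by rewrite (fiber_setD AF fa); exact: big.
have -> : fiber (U `\` (y |` B))%fset f a = (F `\` (y |` B))%fset.
  apply/fsetP => v; rewrite fiberP !in_fsetD fiberP fa.
  by rewrite andbA.
rewrite cardfsDS // cA; lia.
Qed.

Variables (R : realType) (n K : nat) (beta : R).
Local Notation reach := (@reach R d.+1 m n K beta).

(** [U] holds the untreated points and [D] the finished segments; the last hypothesis reserves a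
    width [2 * r * m] per untreated point to the left of [D]. Each part treated has at least two
    points and costs at most [2 + 2 * r * n] steps, whence the factor 2 in the time bound. *)
Lemma reach_spread (r k : nat) (f : pt -> pt) : (0 < m)%N -> (2 * n <= r)%N ->
  (m < n)%N -> (2 * (k + 4 * m + 2) <= K)%N ->
  forall U D Vs, #|` (U `|` D)%fset| = n -> {in U, forall v, v \notin D} ->
  {in U, forall a, (m < #|` fiber U f a|)%N} ->
  {in U &, forall u v, f u = f v -> near_by k u v} ->
  covers D Vs -> spread r Vs ->
  (forall x y, x \in U -> y \in D ->
     x 0 0 + (#|` U| * (2 * r * m))%:Z <= y 0 0) ->
  exists t S Vs', [/\ (2 * t <= #|` U| * (2 + 2 * r * n))%N,
    reach t (U `|` D)%fset S, covers S Vs' & spread r Vs'].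
Proof.
move=> m0 nr mn leK U; move: {2}#|` U| (leqnn #|` U|) => q.
elim: q U => [|q IH] U Uq D Vs cUD UD big near cD sD gap.
  exists 0%N, D, Vs; split => //=.
  by move: Uq; rewrite leqn0 cardfs_eq0 => /eqP->; rewrite fset0U.
have [U0|U0] := eqVneq U fset0.
  by exists 0%N, D, Vs; split => //=; rewrite U0 fset0U.
have [|y yU ymax] := @seq_argmax _ _ _ (fun v : pt => v 0 0) (enum_fset U).
  apply: contra U0 => /eqP e; rewrite -cardfs_eq0 -[#|` _|]/(size _) e //.
have [A [AF yA cA bigA]] := fiber_part yU big.
have AU v : v \in A -> v \in U by move=> /(fsubsetP AF); rewrite fiberP => /andP[].
set U' := (U `\` A)%fset in bigA *.
set s := #|` A| in cA.
have cU : #|` U| = (#|` U'| + s)%N.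
  by rewrite cardfsDS ?subnK //; [apply: fsubset_leq_card|]; apply/fsubsetP.
have Un : (#|` U| <= n)%N by rewrite -cUD fsubset_leq_card // fsubsetUl.
(* Sliding by [T * m] leaves exactly the width reserved for the points of [U']. *)
pose T := (#|` U'| * (2 * r))%N.
pose w := translate y (2 * m + 1 - s).
pose E := (U' `|` D)%fset.
pose V := segm (translate w (T * m)) s.
have eUD : (U `|` D = E `|` A)%fset.
  apply/fsetP => v; rewrite !(in_fsetU, in_fsetD).
  by case: (boolP (v \in A)) => [/AU->|_]; rewrite ?orbT ?orbF //=.
(* The share of one point covers the extent [2 * m] of the new segment and the gap [r] to [D]. *)
have mr : (2 * m + r <= 2 * r * m)%N.
  have : (r <= r * m)%N by rewrite leq_pmulr.
  have : (2 * m * 1 <= r * m)%N by rewrite mulnC; nia.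
  nia.
have TE : (T * m + 2 * r * m <= #|` U| * (2 * r * m))%N.
  rewrite cU /T; nia.
(* Points of [U'] are not to the right of [y] and differ from it, and [D] lies beyond the reserved
   width. *)
have ray i : (i <= 2 * m + T * m)%N -> translate y i \notin E.
  move=> iT; rewrite in_fsetU in_fsetD !negb_or; apply/andP; split.
    apply/negP => /andP[yiA /ymax]; rewrite translate_coord0.
    case: i iT yiA => [|i] iT yiA; first by rewrite translate0 yA in yiA.
    by move: (y 0 0) => a; lia.
  apply/negP => /(gap _ _ yU); rewrite translate_coord0.
  by move: (y 0 0) => a; lia.
have r1 : reach 2 (U `|` D)%fset (E `|` segm w s)%fset.
  rewrite eUD; apply: (@reach_align _ _ _ _ _ _ _ _ _ k) => //.
  - exact: ltnW.
  - by rewrite -eUD.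
  - by move=> u uA; rewrite in_fsetU in_fsetD uA /=; exact: UD (AU _ uA).
  - move=> u uA; split; last by apply: ymax; exact: AU.
    by apply: near; rewrite ?AU //; have := fsubsetP AF _ uA;
      rewrite fiberP => /andP[_ /eqP].
  - by move=> i im; apply: ray; lia.
have c1 : #|` (E `|` segm w s)%fset| = n by apply: reach_card (ltnW mn) cUD r1.
have r2 : reach T (E `|` segm w s)%fset (E `|` V)%fset.
  apply: reach_slide => //; try lia.
  by move=> i iT; rewrite translateD; apply: ray; lia.
have VP v : v \in V -> y 0 0 + (T * m)%:Z <= v 0 0 <= y 0 0 + (T * m + 2 * m)%:Z.
  move=> /segmP[i si ->]; rewrite !translateD translate_coord0.
  by move: (y 0 0) => a; lia.
have eEV : (E `|` V = U' `|` (D `|` V))%fset by rewrite /E fsetUA.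
have c2 : #|` (U' `|` (D `|` V))%fset| = n.
  by rewrite -eEV; apply: reach_card (ltnW mn) c1 r2.
have U'U v : v \in U' -> v \in U by rewrite in_fsetD => /andP[].
have [|||||||t [S [Vs' [tt rt cS sS]]]] := IH U' _ (D `|` V)%fset (V :: Vs) c2.
- lia.
- move=> v vU'; rewrite in_fsetU negb_or UD ?U'U //=.
  have := ray; rewrite /V; apply: contraPN => /segmP[i si ve] rr.
  have : v \notin E.
    by rewrite ve !translateD; apply: rr; lia.
  by rewrite in_fsetU vU'.
- exact: bigA.
- by move=> u v /U'U uU /U'U vU; exact: near.
- by move=> v; rewrite in_fsetU cD /= orbC.
- apply: (@spread_cons r V Vs _ s) => //.
    by rewrite -addn1.
  move=> W x z WV xV zW; have zD : z \in D by rewrite cD; apply/hasP; exists W.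
  have := gap _ _ yU zD; have := VP _ xV.
  by move: (y 0 0) (x 0 0) (z 0 0) => a b c; lia.
- move=> x z xU'; rewrite in_fsetU => /orP[zD|/VP].
    have := gap _ _ (U'U _ xU') zD.
    by rewrite cU mulnDl; move: (x 0 0) (z 0 0) => a b; lia.
  have -> : (T * m = #|` U'| * (2 * r * m))%N by rewrite /T; lia.
  have := ymax _ (U'U _ xU').
  by move: (y 0 0) (x 0 0) (z 0 0) => a b c; lia.
exists (2 + (T + t))%N, S, Vs'; split => //; last first.
  by apply: reach_trans r1 (reach_trans r2 _); rewrite eEV.
rewrite cU mulnDl.
have : (4 + 4 * (r * #|` U'|) <= s * (2 + 2 * r * n))%N.
  have : (r * #|` U'| <= r * n)%N by rewrite leq_mul2l; apply/orP; right; lia.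
  have : (2 * (2 + 2 * r * n) <= s * (2 + 2 * r * n))%N by rewrite leq_mul2r; apply/orP; right; lia.
  lia.
rewrite /T; lia.
Qed.

End Spread.

(** * The three phases fitted into [2 * n ^ 2 * r] steps *)

Theorem theorem1p3 (R : realType) (d m : nat) (hd : (3 <= d)%N)
    (hm : (1 <= m)%N) (beta : R) (hbeta : 2 < beta) (n : nat)
    (hn : (m + 1 <= n)%N) :
  exists p : R, 0 < p /\
    forall (C : {fset 'rV[int]_d}) (r : nat)
           (dO : measure_display) (Omega : measurableType dO)
           (P : probability Omega R)
           (X : nat -> Omega -> {fset 'rV[int]_d}),
      #|` C|%fset = n -> (2 * n <= r)%N -> cat_chain m beta P C X ->
      ((p ^+ r)%:E <=
       P [set w | CanPersist m (r%:R : R) (X (2 * n ^ 2 * r)%N w)])%E.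
Proof.
case: d hd => // d _.
have b0 : 0 <= beta by rewrite (le_trans _ (ltW hbeta)).
have mn : (m < n)%N by rewrite -addn1.
(* [k] bounds the diameter after [n] merges starting from singletons; [K] meets the demands of both
   gathering and aligning. *)
pose k := (n * spread_step m n)%N.
pose K := (2 * (k + 4 * m + 2) + n)%N.
(* The [r]-th power of this constant is one factor [step_min] per step. *)
exists (step_min d.+1 m n K beta ^+ (2 * n ^ 2)); split.
  by rewrite exprn_gt0 // step_min_gt0.
move=> C r dO Omega P X cC nr ch.
have [|||||t1 [C1 [f [t1n r1 near big]]]] :=
  @gather R d m n K beta mn hm C id 0 n k cC.
- by rewrite (leq_trans (leq_imfset_card _ _ _)) // -cC.
- by rewrite add0n.
- by rewrite /K; lia.
- by rewrite /K; lia.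
- by move=> u v _ _ ->; exact: near_by_refl.
have c1 : #|` C1| = n by apply: reach_card (ltnW mn) cC r1.
have [||||||t2 [S [Vs [t2n r2 cS sS]]]] := @reach_spread d m R n K beta r k f
  hm nr mn _ C1 fset0 [::] _ _ big near.
- by rewrite /K; lia.
- by rewrite fsetU0.
- by [].
- by move=> v; rewrite in_fset0.
- by split=> // i j; rewrite ltn0 andbF.
- by move=> x y _; rewrite in_fset0.
rewrite fsetU0 in r2; rewrite c1 in t2n.
have cSn : #|` S| = n by apply: reach_card (ltnW mn) c1 r2.
have lazy : step m n K beta S S.
  have [v vS] : exists v, v \in S.
    by apply/fset0Pn; rewrite -cardfs_gt0 cSn (leq_trans _ mn).
  have := vS; rewrite cS => /hasP[V VV _].
  have [w [s [eV /andP[ms _]]]] := sS.1 V VV.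
  apply: (@step_lazy _ _ _ _ _ _ S w s) => //; first by rewrite /K; lia.
  by apply/fsubsetP => u uV; rewrite cS; apply/hasP; exists V => //; rewrite eV.
have idle j : reach m n K beta j S S by elim: j => // j IH; exists S.
(* Gathering takes at most [n] steps and spreading at most [n + n ^ 2 * r]; the excess [2 * n] is at
   most [n ^ 2 * r]. *)
have tN : (t1 + t2 <= 2 * n ^ 2 * r)%N.
  have : (2 * n <= n * (n * r))%N by rewrite mulnC leq_mul2l; apply/orP; right; nia.
  rewrite -mulnn; lia.
have rN : reach m n K beta (2 * n ^ 2 * r) C S.
  rewrite -(subnKC tN) -addnA.
  exact: reach_trans r1 (reach_trans r2 (idle _)).
rewrite -exprM; apply: (le_trans (cat_chain_reach b0 ch rN)).
have [_ [mX _ _]] := ch.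
apply: le_measure; rewrite ?inE.
- exact: (mX _ [set S]).
- exact: (mX _ (CanPersist m (r%:R : R))).
- move=> w /= ->; apply: spread_CanPersist cS sS _; last by rewrite cSn.
  lia.
Qed.
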